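(* Let $\varepsilon>0$, $\Delta v>0$, $T>0$, $N_t\in\mathbb{N}^*$, $\Delta t=T/N_t$. The semi-discrete scheme $(\mathcal{S}^\varepsilon_{\Delta t,\Delta v})$ (defined in the context) preserves the equilibrium $(v_j^2/2)_{j\in\mathbb{Z}}$: if $\varphi_{\mathrm{in}}(x,v)=v^2/2$ for all $x\in\mathbb{R}$ and $v\in\mathbb{R}$, then its solution satisfies $$\forall n\in\{1,\dots,N_t\},\ \forall j\in\mathbb{Z},\ \forall x\in\mathbb{R},\qquad \varphi_j^{\varepsilon,n}(x)=\frac{v_j^2}{2}.$$
   Context: Discrete velocities $v_j=j\Delta v$, $j\in\mathbb{Z}$. $\langle u\rangle_{\Delta v}=\sum_{j\in\mathbb{Z}}u_j\Delta v$ and $c^\varepsilon_{\Delta v}=\sum_{j\in\mathbb{Z}}e^{-v_j^2/(2\varepsilon)}\Delta v$. Scheme $(\mathcal{S}^\varepsilon_{\Delta t,\Delta v})$: for $x\in\mathbb{R}$, $j\in\mathbb{Z}$, $0\le n\le N_t-1$, with $$m^{\varepsilon,n}(x)=\min_{j\in\mathbb{Z}}\varphi_j^{\varepsilon,n}(x-\Delta t\,v_j),\qquad M_j^{\varepsilon,n}(x)=\min\left\{\varphi_j^{\varepsilon,n}(x-\Delta t\,v_j)+\Delta t,\ \frac{v_j^2}{2}+\mu^{\varepsilon,n+1}(x)\right\},$$ $$\mu^{\varepsilon,n+1}(x)=m^{\varepsilon,n}(x)-\varepsilon\ln\left(\left\langle e^{-[\varphi_j^{\varepsilon,n}(x-\Delta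 t v_j)-m^{\varepsilon,n}(x)]/\varepsilon}\right\rangle_{\Delta v}\right),$$ $$\varphi_j^{\varepsilon,n+1}(x)=M_j^{\varepsilon,n}(x)-\varepsilon\ln\left(c^\varepsilon_{\Delta v}e^{-[\varphi_j^{\varepsilon,n}(x-\Delta t v_j)+\Delta t-M_j^{\varepsilon,n}(x)]/\varepsilon}+(1-e^{-\Delta t/\varepsilon})e^{-[\frac{v_j^2}{2}+\mu^{\varepsilon,n+1}(x)-M_j^{\varepsilon,n}(x)]/\varepsilon}\right)+\varepsilon\ln(c^\varepsilon_{\Delta v}),$$ initialized with $\varphi_j^{\varepsilon,0}(x)=\varphi_{\mathrm{in}}(x,v_j)$ and $\mu^{\varepsilon,0}(x)=\min_{j\in\mathbb{Z}}\varphi_{\mathrm{in}}(x-\Delta t\,v_j,v_j)$. *)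

(* Defs.v *)
From mathcomp Require Import all_boot all_order all_algebra.
From mathcomp Require Import all_classical all_reals all_analysis.

Set Implicit Arguments.
Unset Strict Implicit.
Unset Printing Implicit Defensive.

Import Order.TTheory GRing.Theory Num.Theory.
Import numFieldNormedType.Exports.

Local Open Scope classical_set_scope.
Local Open Scope ring_scope.

(* The attained minimum of a family of reals indexed by Z, with junk value 0
   when no minimum is attained. *)
Definition minZ (R : realType) (f : int -> R) : R :=
  xget 0 (range f `&` lbound (range f)).

Lemma minZE (R : realType) (f : int -> R) (i : int) :
  (forall j, f i <= f j) -> minZ f = f i.
Proof.
move=> fi; apply: xget_unique.
  by split; [exists i | move=> _ [j _ <-]; exact: fi].
move=> _ [[j _ <-] lbj]; apply/le_anti; rewrite fi andbT.
by apply: lbj; exists i.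
Qed.

(* Sum over Z as the sum of two one-sided series; [Negz k] is -(k+1). *)
Definition sumZ (R : realType) (u : int -> R) : R :=
  limn (series (fun k : nat => u (Posz k))) +
  limn (series (fun k : nat => u (Negz k))).

Definition vel (R : realType) (dv : R) (j : int) : R := j%:~R * dv.

Definition avg (R : realType) (dv : R) (u : int -> R) : R :=
  sumZ (fun j => u j * dv).

Definition cnorm (R : realType) (eps dv : R) : R :=
  sumZ (fun j => expR (- (vel dv j ^+ 2 / (2 * eps))) * dv).

(* In the steps below, [phi j x] is phi_j^n(x). *)
Section Scheme.
Variables (R : realType) (eps dt dv : R).
Implicit Types (phi : int -> R -> R) (x : R) (j : int).

Definition transported phi j x : R := phi j (x - dt * vel dv j).

Definition m_step phi x : R := minZ (fun j => transported phi j x).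

Definition mu_step phi x : R :=
  m_step phi x -
  eps * ln (avg dv (fun j => expR (- ((transported phi j x - m_step phi x) / eps)))).

Definition M_step phi j x : R :=
  Num.min (transported phi j x + dt) (vel dv j ^+ 2 / 2 + mu_step phi x).

Definition phi_step phi j x : R :=
  M_step phi j x
  - eps * ln (cnorm eps dv
                * expR (- ((transported phi j x + dt - M_step phi j x) / eps))
              + (1 - expR (- (dt / eps)))
                * expR (- ((vel dv j ^+ 2 / 2 + mu_step phi x
                            - M_step phi j x) / eps)))
  + eps * ln (cnorm eps dv).

Variable phi_in : R -> R -> R.

Fixpoint scheme_phi (n : nat) : int -> R -> R :=
  match n with
  | 0 => fun j x => phi_in x (vel dv j)
  | n'.+1 => phi_step (scheme_phi n')
  end.

Definition scheme_mu (n : nat) : R -> R :=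
  match n with
  | 0 => fun x => minZ (fun j => phi_in (x - dt * vel dv j) (vel dv j))
  | n'.+1 => mu_step (scheme_phi n')
  end.

End Scheme.

(* Main.v *)
Require Import Defs.
From mathcomp Require Import all_boot all_order all_algebra.
From mathcomp Require Import all_classical all_reals all_analysis.
From mathcomp Require Import ring.

Import Order.TTheory GRing.Theory Num.Theory.
Import numFieldNormedType.Exports.

Local Open Scope ring_scope.

(** Write [e_j = v_j^2/2] and [c] for the discrete Gaussian mass.  Free
    transport moves the profile along [x] only, so it leaves [e] alone; the
    minimum over velocities is then [0], reached at [j = 0], and the potential
    is [mu = - eps ln c].  Undoing the logarithms, the update reads
    [exp (- phi_j / eps) =
       exp (- (e_j + dt) / eps) + (1 - exp (- dt / eps)) exp (- e_j / eps)],
    because the two factors [c] (the explicit one, and [exp (- mu / eps)])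
    agree and are divided out by the final [+ eps ln c].  The right-hand side
    is a convex combination of [exp (- e_j / eps)] with itself, and
    [phi_j = e_j].  The shift [M_j] enters both exponentials with the same
    factor and cancels ([relaxation_fixpoint]), whatever its value.

    Cancelling the logarithms requires [c] to be a genuine positive number,
    that is, the Gaussian series must converge ([cnorm_gt0]); this follows by
    comparison with a geometric series since [k <= k^2]. *)

(** Linear growth of [w] bounds the terms by those of a geometric series of
    ratio [expR (- a)]; the limit then dominates the first term. *)
Lemma lim_series_exp_gt0 (R : realType) (a b : R) (w : nat -> R) :
  0 < a -> 0 < b -> (forall k, k%:R <= w k) ->
  0 < limn (series (fun k => expR (- (a * w k)) * b)).
Proof.
move=> a0 b0 kw.
have u0 k : 0 < expR (- (a * w k)) * b by rewrite mulr_gt0 ?expR_gt0.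
have cvg_u : cvgn (series (fun k => expR (- (a * w k)) * b)).
  apply: (@series_le_cvg _ _ (geometric b (expR (- a)))).
  - by move=> k; apply: ltW.
  - by move=> k; rewrite /= mulr_ge0 ?exprn_ge0 ?expR_ge0 ?ltW.
  - move=> k; rewrite /= mulrC ler_pM2l // -expRM_natl ler_expR mulrN lerN2.
    by rewrite mulrC ler_pM2l.
  apply: is_cvg_geometric_series.
  by rewrite ger0_norm ?expR_ge0 // expR_lt1 oppr_lt0.
have incr_u : nondecreasing_seq (series (fun k => expR (- (a * w k)) * b)).
  by apply/nondecreasing_series => k _ _; apply: ltW.
apply: lt_le_trans (nondecreasing_cvgn_le incr_u cvg_u 1%N).
by rewrite /series /= big_nat1.
Qed.

Lemma cnorm_gt0 (R : realType) (eps dv : R) :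
  0 < eps -> 0 < dv -> 0 < cnorm eps dv.
Proof.
move=> eps0 dv0; rewrite /cnorm /sumZ.
have a0 : 0 < dv ^+ 2 / (2 * eps) by rewrite divr_gt0 ?exprn_gt0 ?mulr_gt0.
have velE j : vel dv j ^+ 2 / (2 * eps) = dv ^+ 2 / (2 * eps) * j%:~R ^+ 2.
  by rewrite /vel exprMn [X in X / _]mulrC mulrAC.
under eq_fun do rewrite velE.
under [X in _ + limn (series X)]eq_fun do rewrite velE.
apply: addr_gt0; apply: lim_series_exp_gt0 => // k.
  by rewrite -pmulrn -natrX ler_nat; case: k => // k; rewrite -mulnn leq_pmulr.
rewrite NegzE mulrNz sqrrN -pmulrn -natrX ler_nat.
by rewrite (leq_trans (leqnSn k)) // -mulnn leq_pmulr.
Qed.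

(** The two exponentials carry the same factor
    [c * expR (- ((e - M) / eps))], with weights [expR (- (dt / eps))] and
    [1 - expR (- (dt / eps))] that add up to one. *)
Lemma relaxation_fixpoint (R : realType) (eps dt c e M : R) :
  0 < eps -> 0 < c ->
  M - eps * ln (c * expR (- ((e + dt - M) / eps))
                + (1 - expR (- (dt / eps)))
                  * expR (- ((e - eps * ln c - M) / eps)))
    + eps * ln c = e.
Proof.
move=> eps0 c0; have eps_neq0 : eps != 0 by rewrite gt_eqF.
have -> : - ((e + dt - M) / eps) = - (dt / eps) - (e - M) / eps by field.
have -> : - ((e - eps * ln c - M) / eps) = ln c - (e - M) / eps by field.
rewrite !expRD lnK //.
set q := expR (- (dt / eps)); set r := expR (- ((e - M) / eps)).
have -> : c * (q * r) + (1 - q) * (c * r) = c * r by ring.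
rewrite lnM ?posrE ?expR_gt0 // expRK.
by field.
Qed.

Section Equilibrium.
Variables (R : realType) (eps dt dv : R) (phi : int -> R -> R).
Hypotheses (eps0 : 0 < eps) (dv0 : 0 < dv).
Hypothesis phi_eq : forall j x, phi j x = vel dv j ^+ 2 / 2.

Lemma m_step_equilibrium x : m_step dt dv phi x = 0.
Proof.
rewrite /m_step (@minZE _ _ 0) /transported => [|j]; rewrite !phi_eq.
  by rewrite /vel mul0r expr0n mul0r.
by rewrite /vel mul0r expr0n mul0r divr_ge0 ?sqr_ge0.
Qed.

Lemma mu_step_equilibrium x :
  mu_step eps dt dv phi x = - (eps * ln (cnorm eps dv)).
Proof.
rewrite /mu_step m_step_equilibrium sub0r /avg /cnorm.
congr (- (eps * ln (sumZ _))); apply/funext => j.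
by rewrite /transported phi_eq subr0 invfM mulrA.
Qed.

Lemma phi_step_equilibrium j x : phi_step eps dt dv phi j x = vel dv j ^+ 2 / 2.
Proof.
rewrite /phi_step; move: (M_step _ _ _ _ _ _) => M.
by rewrite mu_step_equilibrium /transported phi_eq relaxation_fixpoint ?cnorm_gt0.
Qed.

End Equilibrium.

Theorem lemma3p1 (R : realType) (eps dv T : R) (Nt : nat) (dt : R)
    (phi_in : R -> R -> R) :
  0 < eps -> 0 < dv -> 0 < T -> (0 < Nt)%N -> dt = T / Nt%:R ->
  (forall x v : R, phi_in x v = v ^+ 2 / 2) ->
  forall n : nat, (1 <= n <= Nt)%N ->
  forall (j : int) (x : R),
    scheme_phi eps dt dv phi_in n j x = vel dv j ^+ 2 / 2.
Proof.
move=> eps0 dv0 _ _ _ phi_inE n _.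
elim: n => [|n IHn] j x /=; first exact: phi_inE.
exact: phi_step_equilibrium.
Qed.
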